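(* Let $(X,\mathcal{K})$ be a pair satisfying assumptions $(A0')$ and $(A1)$. For a function $f:X\rightarrow\overline{\mathcal{K}}$ the following statements are equivalent: 1°. $f$ is anti-topical. 2°. $f(\inf X)=\top$ and $f^{\theta(\varphi)}(y)\geq f(y)^{-1}$ for all $y\in X$. 3°. $f(\inf X)=\top$ and $f^{\theta(\varphi)}(y)=f(y)^{-1}$ for all $y\in X$. 4°. $f(\inf X)=\top$ and $f^{\theta(\psi)}(y,d)\geq f(y)^{-1}$ for all $y\in X$ and all $d\in\mathcal{K}$. 5°. $f(\inf X)=\top$ and $f^{\theta(\psi)}(y,d)=f(y)^{-1}$ for all $y\in X$ and all $d\in\mathcal{K}$.
   Context: $(A0')$: $\mathcal{K}=(\mathcal{K},\oplus,\otimes)$ is a $b$-complete idempotent semifield, i.e. a semiring with idempotent addition, with zero $\varepsilon$ (neutral for $\oplus$, absorbing for $\otimes$) and unit $e$, in which every $\mu\neq\varepsilon$ is invertible for $\otimes$, ordered by $\lambda\leq\mu\Leftrightarrow\lambda\oplus\mu=\mu$, such that every subset bounded from above has a supremum (its sum) in $\mathcal{K}$ and $\otimes$ distributes over such suprema (such a $\mathcal{K}$ is commutative); and $X$ is a $b$-complete idempotent semimodule over $\mathcal{K}$: a semimodule with idempotent addition, ordered by $x\leq y\Leftrightarrow x\oplus y=y$, in which every subset bounded from above has a supremum (its sum), and the action $(\lambda,x)\mapsto\lambda x$ distributes over suprema of bounded-above sets of scalars and of vectors. Its zero is $\inf X$; thus $\varepsilon x=\inf X$ for $x\in X$ and $\lambda\inf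 X=\inf X$ for $\lambda\in\mathcal{K}$. $(A1)$: for all $x\in X$, $y\in X\setminus\{\inf X\}$ the set $\{\lambda\in\mathcal{K}:\lambda y\leq x\}$ is bounded from above in $\mathcal{K}$. It is assumed throughout that $\mathcal{K}$ has no greatest element. Minimal enlargement: $\overline{\mathcal{K}}=\mathcal{K}\cup\{\top\}$, with $\top\notin\mathcal{K}$, $\alpha\leq\top$ and $\alpha\oplus\top=\top$ for all $\alpha\in\overline{\mathcal{K}}$. The product $\dot{\otimes}$ on $\overline{\mathcal{K}}$ is defined by $\alpha\dot{\otimes}\beta=\alpha\otimes\beta$ for $\alpha,\beta\in\mathcal{K}$, and $\alpha\dot{\otimes}\top=\top\dot{\otimes}\alpha=\top$ for $\alpha\in\overline{\mathcal{K}}$. Conventions: $\varepsilon^{-1}=\top$, $\top^{-1}=\varepsilon$. Suprema and infima of values are taken in $\overline{\mathcal{K}}$. Extended residuation: $x/y:=\sup\{\lambda\in\mathcal{K}:\lambda y\leq x\}\in\overline{\mathcal{K}}$ for all $x,y\in X$ (so $x/\inf X=\top$). A function $f:X\to\overline{\mathcal{K}}$ is anti-topical if it is decreasing ($x'\leq x''\Rightarrow f(x')\geq f(x'')$) and anti-homogeneous ($f(\lambda x)=\lambda^{-1}\dot{\otimes}f(x)$ for all $x\in X,\lambda\in\mathcal{K}$). Lower conjugates of $f:X\to\overline{\mathcal{K}}$ (with respect to the coupling functions $\varphi(x,y)=x/y$ and $\psi(x,(y,d))=\inf\{x/y,d\}$): $$f^{\theta(\varphi)}(y):=\inf_{x\in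 X}f(x)^{-1}\dot{\otimes}(x/y)^{-1},\qquad f^{\theta(\psi)}(y,d):=\inf_{x\in X}f(x)^{-1}\dot{\otimes}\overline{s}_{y,d}(x),\qquad y\in X,\ d\in\overline{\mathcal{K}},$$ where $\overline{s}_{y,d}(x):=\sup\{(x/y)^{-1},d\}$. *)

(* Defs.v *)
From HB Require Import structures.
From mathcomp Require Import all_boot all_algebra.
From mathcomp Require Import mathcomp_extra boolp classical_sets.
Set Implicit Arguments.
Unset Strict Implicit.
Unset Printing Implicit Defensive.
Import GRing.Theory.
Local Open Scope classical_set_scope.
Local Open Scope ring_scope.

Section Lub.
Context {T : Type} (R : T -> T -> Prop).

Definition is_lub (A : set T) (s : T) : Prop :=
  (forall a, A a -> R a s) /\ (forall u, (forall a, A a -> R a u) -> R s u).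

Definition bounded_above (A : set T) : Prop :=
  exists u, forall a, A a -> R a u.

End Lub.

Definition is_glb {T : Type} (R : T -> T -> Prop) : set T -> T -> Prop :=
  is_lub (fun x y => R y x).

(* The natural order of an idempotent additive monoid. Since 0 + x = x, the    *)
(* zero of the monoid is its least element; in particular inf X is 0 : X.      *)
Definition ile {V : nmodType} (x y : V) : Prop := x + y = y.

Definition b_complete_idempotent (V : nmodType) : Prop :=
  (forall x : V, x + x = x) /\
  (forall A : set V, bounded_above ile A -> exists s, is_lub ile A s).

Definition is_inverse {K : pzSemiRingType} (a b : K) : Prop :=
  a * b = 1 /\ b * a = 1.

(* Commutativity of the product is a consequence of these axioms and is not    *)
(* assumed; hence distributivity is required on both sides.                    *)
Record b_complete_idempotent_semifield (K : pzSemiRingType) : Prop := {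
  semifield_b_complete : b_complete_idempotent K;
  semifield_inverse : forall a : K, a <> 0 -> exists b, is_inverse a b;
  semifield_distl : forall (m : K) (A : set K) (s : K),
    is_lub ile A s -> is_lub ile [set m * a | a in A] (m * s);
  semifield_distr : forall (m : K) (A : set K) (s : K),
    is_lub ile A s -> is_lub ile [set a * m | a in A] (s * m)
}.

Record b_complete_idempotent_semimodule (K : pzSemiRingType)
    (X : lSemiModType K) : Prop := {
  semimodule_b_complete : b_complete_idempotent X;
  semimodule_dist_scalar : forall (A : set K) (s : K) (x : X),
    is_lub ile A s -> is_lub ile [set l *: x | l in A] (s *: x);
  semimodule_dist_vector : forall (l : K) (A : set X) (s : X),
    is_lub ile A s -> is_lub ile [set l *: x | x in A] (l *: s)
}.

Definition assumption_A0' (K : pzSemiRingType) (X : lSemiModType K) : Prop :=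
  b_complete_idempotent_semifield K /\ b_complete_idempotent_semimodule X.

Definition assumption_A1 (K : pzSemiRingType) (X : lSemiModType K) : Prop :=
  forall x y : X, y <> 0 -> bounded_above ile [set l : K | ile (l *: y) x].

Definition no_greatest (K : pzSemiRingType) : Prop :=
  ~ exists g : K, forall a : K, ile a g.

(* The minimal enlargement: Some embeds K and None is the added top element.   *)
Definition Kbar (K : pzSemiRingType) : Type := option K.

Section MinimalEnlargement.
Context {K : pzSemiRingType}.

Definition fin (a : K) : Kbar K := Some a.
Definition top : Kbar K := None.

Definition leb (a b : Kbar K) : Prop :=
  match a, b with
  | _, None => True
  | None, Some _ => False
  | Some a, Some b => ile a b
  end.

Definition mulb (a b : Kbar K) : Kbar K :=
  match a, b with
  | Some a, Some b => fin (a * b)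
  | _, _ => top
  end.

(* The default 0 of xget is never used in a semifield.                         *)
Definition invb (a : Kbar K) : Kbar K :=
  match a with
  | None => fin 0
  | Some a => if a == 0 then top else fin (xget 0 [set b | is_inverse a b])
  end.

(* Kbar is a complete lattice when K is b-complete (lubbP and glbbP below), so *)
(* the default value of xget is never used then.                               *)
Definition lubb (A : set (Kbar K)) : Kbar K := xget top [set s | is_lub leb A s].
Definition glbb (A : set (Kbar K)) : Kbar K := xget top [set s | is_glb leb A s].

Lemma lubbP (A : set (Kbar K)) : b_complete_idempotent K -> is_lub leb A (lubb A).
Proof.
move=> [idK compK]; apply: (@xgetPex _ _ [set s | is_lub leb A s]).
have [[[u|] ubu]|nub] := pselect (exists u : Kbar K, u <> top /\ forall a, A a -> leb a u).
- have [_ {}ubu] := ubu.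
  have [|s [ubs lebs]] := compK [set a | A (fin a)].
    by exists u => a /= /ubu.
  exists (fin s); split.
    by move=> [a|] Aa; [exact: ubs | have := ubu _ Aa].
  move=> [v|] // ubv; apply: lebs => a Aa; exact: (ubv _ Aa).
- by case: ubu.
- exists top; split; first by case.
  by move=> [v|] // ubv; apply: nub; exists (fin v).
Qed.

Lemma glbbP (A : set (Kbar K)) : b_complete_idempotent K -> is_glb leb A (glbb A).
Proof.
move=> cK; apply: (@xgetPex _ _ [set s | is_glb leb A s]).
have [ub least] := lubbP [set l | forall a, A a -> leb l a] cK.
exists (lubb [set l | forall a, A a -> leb l a]); split => [a Aa|u lbu].
  by apply: least => l; apply.
exact: ub.
Qed.

End MinimalEnlargement.

Section Conjugates.
Context {K : pzSemiRingType} {X : lSemiModType K}.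

Definition resid (x y : X) : Kbar K :=
  lubb [set fin l | l in [set l : K | ile (l *: y) x]].

Definition sbar (y : X) (d : Kbar K) (x : X) : Kbar K :=
  lubb [set invb (resid x y); d].

Definition anti_topical (f : X -> Kbar K) : Prop :=
  (forall x' x'' : X, ile x' x'' -> leb (f x'') (f x')) /\
  (forall (x : X) (l : K), f (l *: x) = mulb (invb (fin l)) (f x)).

Definition conj_phi (f : X -> Kbar K) (y : X) : Kbar K :=
  glbb (range (fun x : X => mulb (invb (f x)) (invb (resid x y)))).

Definition conj_psi (f : X -> Kbar K) (y : X) (d : Kbar K) : Kbar K :=
  glbb (range (fun x : X => mulb (invb (f x)) (sbar y d x))).

End Conjugates.

(* Main.v *)
Require Import Defs.
From mathcomp Require Import all_boot all_algebra.
From mathcomp Require Import mathcomp_extra boolp classical_sets.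
Set Implicit Arguments.
Unset Strict Implicit.
Unset Printing Implicit Defensive.
Import GRing.Theory.
Local Open Scope ring_scope.

(** Both conjugate inequalities amount to: [l *: y <= x] with [l] invertible
    forces [f x <= l^-1 (f y)]. Indeed, by (A1) and distributivity, [x / y] is
    attained, i.e. [(x / y) *: y <= x], unless [y = inf X]. Conversely, taking
    [l = 1] gives monotonicity, and applying the estimate to the pairs
    [(l *: y, y)] and [(y, l *: y)] gives anti-homogeneity. For the coupling psi,
    the choice [d = 0] recovers the coupling phi, and the infimum is attained at
    [x = l *: y] for any invertible [l] with [d <= l^-1]. *)

(** * Order of an idempotent monoid *)

Section NaturalOrder.
Context {V : nmodType}.
Implicit Types x y z : V.

Lemma ile_trans x y z : ile x y -> ile y z -> ile x z.
Proof. by rewrite /ile => xy yz; rewrite -yz addrA xy. Qed.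

Lemma ile_anti x y : ile x y -> ile y x -> x = y.
Proof. by rewrite /ile => xy yx; rewrite -xy addrC yx. Qed.

Lemma ile0 x : ile 0 x.
Proof. exact: add0r. Qed.

End NaturalOrder.

Lemma ile_mul (K : pzSemiRingType) (a b c d : K) :
  ile a b -> ile c d -> ile (a * c) (b * d).
Proof.
move=> ab cd; apply: (@ile_trans _ _ (b * c)).
  by rewrite /ile -mulrDl ab.
by rewrite /ile -mulrDr cd.
Qed.

(** * Products and inversion in the enlarged semifield *)

Section EnlargedSemifield.
Context {K : pzSemiRingType} (hK : b_complete_idempotent_semifield K).
Context (one_neq0 : (1 : K) <> 0).
Implicit Types (l : K) (a b c d : Kbar K).

Let idK : forall l, l + l = l := proj1 (semifield_b_complete hK).

Lemma leb_refl a : leb a a.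
Proof. by case: a => //= l; exact: idK. Qed.

Lemma leb_trans a b c : leb a b -> leb b c -> leb a c.
Proof. by case: a b c => [a|] [b|] [c|] //=; exact: ile_trans. Qed.

Lemma leb_anti a b : leb a b -> leb b a -> a = b.
Proof.
by case: a b => [a|] [b|] //= ab ba; congr Some; exact: (ile_anti ab ba).
Qed.

Lemma leb_top a : leb a top.
Proof. by case: a. Qed.

Lemma le0b a : leb (fin 0) a.
Proof. by case: a => //= l; exact: ile0. Qed.

Lemma mulb_le a b c d : leb a b -> leb c d -> leb (mulb a c) (mulb b d).
Proof.
by case: a b c d => [a|] [b|] [c|] [d|] //=; exact: ile_mul.
Qed.

Lemma mulbA a b c : mulb a (mulb b c) = mulb (mulb a b) c.
Proof. by case: a b c => [a|] [b|] [c|] //=; rewrite mulrA. Qed.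

Lemma mulb_fin l m : mulb (fin l) (fin m) = fin (l * m).
Proof. by []. Qed.

Lemma mulb_top a : mulb a top = top.
Proof. by case: a. Qed.

Lemma mulb1 a : mulb a (fin 1) = a.
Proof. by case: a => //= l; rewrite mulr1. Qed.

Lemma mul1b a : mulb (fin 1) a = a.
Proof. by case: a => //= l; rewrite mul1r. Qed.

Lemma inverse_unique l m n : is_inverse l m -> is_inverse l n -> m = n.
Proof. by move=> [_ ml] [ln _]; rewrite -[m]mulr1 -ln mulrA ml mul1r. Qed.

Lemma inverse_sym l m : is_inverse l m -> is_inverse m l.
Proof. by case. Qed.

Lemma inverse_neq0 l m : is_inverse l m -> l <> 0.
Proof. by move=> [lm _] l0; apply: one_neq0; rewrite -lm l0 mul0r. Qed.

Lemma invb0 : invb (fin (0 : K)) = top.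
Proof. by rewrite /= eqxx. Qed.

Lemma invb_inverse l m : is_inverse l m -> invb (fin l) = fin m.
Proof.
move=> lm /=; rewrite (negbTE (introN eqP (inverse_neq0 lm))); congr fin.
have lx : is_inverse l (xget 0 [set b | is_inverse l b]%classic).
  by apply: (@xgetPex _ _ [set b | is_inverse l b]%classic); exists m.
exact: (inverse_unique lx lm).
Qed.

(** Splits [a] and [invb a] together into the cases 0, [top] and invertible, so that the choice made
    by [xget] in [invb] stays hidden. *)
Variant kbar_spec : Kbar K -> Kbar K -> Prop :=
  | KbarZero : kbar_spec (fin 0) top
  | KbarTop : kbar_spec top (fin 0)
  | KbarUnit l m of is_inverse l m : kbar_spec (fin l) (fin m).

Lemma kbarP a : kbar_spec a (invb a).
Proof.
case: a => [l|]; last exact: KbarTop.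
have [->|/eqP l0] := eqVneq l 0; first by rewrite invb0; exact: KbarZero.
have [m lm] := semifield_inverse hK l0.
by rewrite (invb_inverse lm); exact: KbarUnit.
Qed.

Lemma invbK a : invb (invb a) = a.
Proof.
case: (kbarP a) => [//||l m /inverse_sym]; first exact: invb0.
exact: invb_inverse.
Qed.

Lemma invb_le a b : leb a b -> leb (invb b) (invb a).
Proof.
case: (kbarP a) => [_||l m [lm ml]]; first exact: leb_top.
  by case: b => // _; exact: leb_refl.
case: (kbarP b) => [/= l0|_|l' m' [lm' ml']]; last 1 first.
- move=> /= ll'.
  (* As [l * m = 1] and [m' * l' = 1], multiplying [l <= l'] by [m'] on the left and [m] on the
     right yields [m' <= m]. *)
  suff : ile (m' * l * m) (m' * l' * m) by rewrite -mulrA lm mulr1 ml' mul1r.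
  apply: ile_mul; last exact: idK.
  by apply: ile_mul; first exact: idK.
- have l_eq0 : l = 0 by apply: (ile_anti l0); exact: ile0.
  by case: one_neq0; rewrite -lm l_eq0 mul0r.
- exact: le0b.
Qed.

(** Inversion reverses the factors. Invertibility of [l] matters: [0 * top = top] has inverse 0,
    whereas inverting the factors gives [top]. *)
Lemma invb_mull l m a : is_inverse l m ->
  invb (mulb (fin l) a) = mulb (invb a) (fin m).
Proof.
move=> lm; case: (kbarP a) => [||k n [kn nk]] /=.
- by rewrite mulr0 eqxx.
- by rewrite mul0r.
- have [lm1 ml1] := lm; apply: invb_inverse; split.
    by rewrite mulrA -(mulrA l) kn mulr1.
  by rewrite mulrA -(mulrA n) ml1 mulr1.
Qed.

(** Invert both sides and cancel [l] against [m] on the right. This turns [f x <= l^-1 (f y)] into a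
    bound by a term of the conjugate. *)
Lemma mulb_le_inverse l m a b : is_inverse l m ->
  leb a (mulb (fin m) b) <-> leb (invb b) (mulb (invb a) (fin m)).
Proof.
move=> lm; have [lm1 ml1] := lm.
have invb_mb : invb (mulb (fin m) b) = mulb (invb b) (fin l).
  exact/invb_mull/inverse_sym.
split=> [/invb_le|ba].
  rewrite invb_mb => /(fun h => mulb_le h (leb_refl (fin m))).
  by rewrite -mulbA mulb_fin lm1 mulb1.
rewrite -[a]invbK -[mulb (fin m) b]invbK; apply: invb_le; rewrite invb_mb.
have := mulb_le ba (leb_refl (fin l)).
by rewrite -mulbA mulb_fin ml1 mulb1.
Qed.

End EnlargedSemifield.

(** * Residuals: attainment and the value [top] *)

Section Conjugation.
Context {K : pzSemiRingType} {X : lSemiModType K}.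
Context (hA0' : assumption_A0' X) (hA1 : assumption_A1 X).
Context (one_neq0 : (1 : K) <> 0).
Implicit Types (x y : X) (l m : K) (f : X -> Kbar K).

Let hK : b_complete_idempotent_semifield K := proj1 hA0'.
Let hX : b_complete_idempotent_semimodule X := proj2 hA0'.
Let cK : b_complete_idempotent K := semifield_b_complete hK.
Let idX : forall x, x + x = x := proj1 (semimodule_b_complete hX).

Let scalars_below x y : set K := [set l : K | ile (l *: y) x]%classic.

Lemma le_resid x y l : ile (l *: y) x -> leb (fin l) (resid x y).
Proof.
move=> lyx; have [ub _] := lubbP [set fin l | l in scalars_below x y]%classic cK.
by apply: ub; exists l.
Qed.

(** A finite residual is also a supremum in [K], and the action distributes over it; [x] bounds all
    the products, hence also [l *: y]. *)
Lemma resid_scale_le x y l : resid x y = fin l -> ile (l *: y) x.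
Proof.
have [ub least] := lubbP [set fin l | l in scalars_below x y]%classic cK.
rewrite -/(resid x y) in ub least => xyl; rewrite xyl in ub least.
have lubl : is_lub ile (scalars_below x y) l.
  split=> [k kyx|u ubu]; first by apply: (ub (fin k)); exists k.
  by apply: (least (fin u)) => _ [k kyx <-]; exact: ubu.
have [_] := semimodule_dist_scalar hX y lubl.
by apply=> _ [k kyx <-].
Qed.

(** For [y <> 0], (A1) bounds the scalars by some [u] in [K], so the residual is at most [fin u]. *)
Lemma resid_top x y : resid x y = top -> y = 0.
Proof.
move=> xytop; apply: contrapT => /(hA1 x)[u ubu].
have [_ /(_ (fin u))] := lubbP [set fin l | l in scalars_below x y]%classic cK.
rewrite -/(resid x y) xytop; apply=> _ [l lyx <-]; exact: ubu.
Qed.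

(** * The two conjugates as infima, and their comparison *)

Lemma conj_phi_le f x y : leb (conj_phi f y) (mulb (invb (f x)) (invb (resid x y))).
Proof.
have [lb _] := glbbP (range (fun x => mulb (invb (f x)) (invb (resid x y)))) cK.
by apply: lb; exists x.
Qed.

Lemma le_conj_phi f y a :
  (forall x, leb a (mulb (invb (f x)) (invb (resid x y)))) -> leb a (conj_phi f y).
Proof.
move=> lba.
have [_] := glbbP (range (fun x => mulb (invb (f x)) (invb (resid x y)))) cK.
by apply=> _ [x _ <-].
Qed.

Lemma conj_psi_le f x y d : leb (conj_psi f y d) (mulb (invb (f x)) (sbar y d x)).
Proof.
have [lb _] := glbbP (range (fun x => mulb (invb (f x)) (sbar y d x))) cK.
by apply: lb; exists x.
Qed.

Lemma le_conj_psi f y d a :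
  (forall x, leb a (mulb (invb (f x)) (sbar y d x))) -> leb a (conj_psi f y d).
Proof.
move=> lba.
have [_] := glbbP (range (fun x => mulb (invb (f x)) (sbar y d x))) cK.
by apply=> _ [x _ <-].
Qed.

Lemma invb_resid_le_sbar x y d : leb (invb (resid x y)) (sbar y d x).
Proof.
have [ub _] := lubbP [set invb (resid x y); d]%classic cK.
by apply: ub; left.
Qed.

Lemma sbar_le x y d a :
  leb (invb (resid x y)) a -> leb d a -> leb (sbar y d x) a.
Proof.
move=> xya da; have [_] := lubbP [set invb (resid x y); d]%classic cK.
by apply=> _ [->|->].
Qed.

Lemma conj_phi_le_psi f y d : leb (conj_phi f y) (conj_psi f y d).
Proof.
apply: le_conj_psi => x; apply: (leb_trans (conj_phi_le f x y)).
by apply: mulb_le; [exact: (leb_refl hK) | exact: invb_resid_le_sbar].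
Qed.

Lemma conj_psi0 f y : conj_psi f y (fin 0) = conj_phi f y.
Proof.
apply: leb_anti; last exact: conj_phi_le_psi.
apply: le_conj_phi => x; apply: (leb_trans (conj_psi_le f x y (fin 0))).
apply: mulb_le; first exact: (leb_refl hK).
by apply: sbar_le; [exact: (leb_refl hK) | exact: le0b].
Qed.

Lemma invb_resid_le x y l m : is_inverse l m -> ile (l *: y) x ->
  leb (invb (resid x y)) (fin m).
Proof.
move=> lm /le_resid/(invb_le hK one_neq0).
by rewrite (invb_inverse one_neq0 lm).
Qed.

(** The term at [x = y] suffices: the inverse of [y / y] is at most 1. *)
Lemma conj_phi_le_invb f y : leb (conj_phi f y) (invb (f y)).
Proof.
apply: (leb_trans (conj_phi_le f y y)); rewrite -[X in leb _ X]mulb1.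
apply: mulb_le; first exact: (leb_refl hK).
apply: (@invb_resid_le _ _ 1); first by rewrite /is_inverse mulr1.
by rewrite scale1r; exact: idX.
Qed.

(** * Anti-topical functions in terms of conjugates *)

Lemma anti_topical0 f : anti_topical f -> f 0 = top.
Proof. by move=> [_ hf]; rewrite -(scale0r (0 : X)) hf invb0. Qed.

Lemma anti_topical_conj_phi f y :
  anti_topical f -> leb (invb (f y)) (conj_phi f y).
Proof.
move=> af; have [decf homf] := af; apply: le_conj_phi => x.
have := @resid_top x y; have := @resid_scale_le x y.
case: (kbarP hK one_neq0 (resid x y)) => [_ _|_|l m lm].
- by rewrite mulb_top; exact: leb_top.
(* Residual [top]: here [y = 0], so the left side is the inverse of [f 0 = top], namely 0. *)
- by move=> ->//; rewrite (anti_topical0 af); exact: le0b.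
- move=> /(_ l erefl)/decf; rewrite homf (invb_inverse one_neq0 lm) => fxy _.
  exact/(mulb_le_inverse hK one_neq0 _ _ lm).
Qed.

Lemma conj_phi_anti_topical f : f 0 = top ->
  (forall y, leb (invb (f y)) (conj_phi f y)) -> anti_topical f.
Proof.
move=> f0 hf.
have f_le x y l m : is_inverse l m -> ile (l *: y) x ->
    leb (f x) (mulb (fin m) (f y)).
  move=> lm lyx; apply/(mulb_le_inverse hK one_neq0 _ _ lm).
  apply: (leb_trans (hf y)); apply: (leb_trans (conj_phi_le f x y)).
  by apply: mulb_le; [exact: (leb_refl hK) | exact: invb_resid_le lm lyx].
split=> [y x yx|x l].
  rewrite -[X in leb _ X]mul1b; apply: (@f_le _ _ 1).
    by rewrite /is_inverse mulr1.
  by rewrite scale1r.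
(* At [l = 0] both sides are [top]: the left by [f 0 = top], the right because [top] absorbs. *)
have [->|/eqP l0] := eqVneq l 0; first by rewrite scale0r f0 invb0.
have [m lm] := semifield_inverse hK l0; have [lm1 ml1] := lm.
rewrite (invb_inverse one_neq0 lm).
apply: leb_anti; first by apply: (f_le _ _ _ _ lm); exact: idX.
(* Scaling [l *: x] back by [m] gives [f x <= l (f (l *: x))]; multiply by [m] on the left. *)
have := f_le x (l *: x) m l (inverse_sym lm).
rewrite scalerA ml1 scale1r => /(_ (idX x)).
move=> /(mulb_le (leb_refl hK (fin m))).
by rewrite mulbA mulb_fin ml1 mul1b.
Qed.

Lemma conj_psi_le_invb f y (d : K) :
  anti_topical f -> leb (conj_psi f y (fin d)) (invb (f y)).
Proof.
move=> [decf homf].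
(* Take [m = d] if [d] is invertible and [m = 1] if [d = 0]; then [m] bounds both entries of
   [sbar y d (l *: y)]. *)
have [l [m [lm dm]]] : exists l m, is_inverse l m /\ ile d m.
  have [->|/eqP d0] := eqVneq d 0.
    by exists 1, 1; split; [rewrite /is_inverse mulr1 | exact: ile0].
  have [l dl] := semifield_inverse hK d0.
  by exists l, d; split; [exact: inverse_sym | exact: (proj1 cK)].
have [lm1 ml1] := lm.
apply: (leb_trans (conj_psi_le f (l *: y) y (fin d))).
(* By anti-homogeneity the scaling of the test point cancels the factor [m]. *)
have -> : invb (f y) = mulb (invb (f (l *: y))) (fin m).
  rewrite homf (invb_inverse one_neq0 lm).
  rewrite (invb_mull hK one_neq0 _ (inverse_sym lm)).
  by rewrite -mulbA mulb_fin lm1 mulb1.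
apply: mulb_le; first exact: (leb_refl hK).
by apply: sbar_le => //; apply: invb_resid_le lm _; exact: idX.
Qed.

End Conjugation.

Theorem theorem36 (K : pzSemiRingType) (X : lSemiModType K)
    (hA0' : assumption_A0' X) (hA1 : assumption_A1 X) (hK : no_greatest K)
    (f : X -> Kbar K) :
  [<-> anti_topical f;
       f 0 = top /\ (forall y : X, leb (invb (f y)) (conj_phi f y));
       f 0 = top /\ (forall y : X, conj_phi f y = invb (f y));
       f 0 = top /\
         (forall (y : X) (d : K), leb (invb (f y)) (conj_psi f y (fin d)));
       f 0 = top /\
         (forall (y : X) (d : K), conj_psi f y (fin d) = invb (f y))].
Proof.
have one_neq0 : (1 : K) <> 0.
  (* If [1 = 0], then [K] reduces to 0, which would be its greatest element. *)
  move=> K0; apply: hK; exists 0 => a.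
  by rewrite /ile addr0 -[a]mulr1 K0 mulr0.
have le_bb := leb_refl (proj1 hA0').
tfae.
- move=> af; split=> [|y]; first exact: anti_topical0 af.
  exact: anti_topical_conj_phi.
- move=> [f0 hf]; split=> // y; apply: leb_anti => //.
  exact: conj_phi_le_invb.
- move=> [f0 hf]; split=> // y d; rewrite -hf.
  exact: conj_phi_le_psi.
- move=> [f0 hf]; split=> // y d; apply: leb_anti => //.
  (* The upper bound requires [f] anti-topical, which the case [d = 0] of the hypothesis
     supplies. *)
  apply: conj_psi_le_invb => //; apply: conj_phi_anti_topical => // z.
  by rewrite -conj_psi0.
- move=> [f0 hf]; apply: conj_phi_anti_topical => // y.
  by rewrite -(hf y 0) conj_psi0.
Qed.
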